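(* Let $m\ge 1$, $0\le i\le 2^m-1$, and suppose $a\neq 0$, $a\in\mathbb{C}$. Then $R_{i\times(a)}^{-1}=R_{i\times(\frac{1}{a})}$, i.e. $R_{i\times(a)}R_{i\times(\frac{1}{a})}=R_{i\times(\frac{1}{a})}R_{i\times(a)}=I$.
   Context: Rows and columns of $2^m\times 2^m$ complex matrices are indexed from $0$ to $2^m-1$. For $a\in\mathbb{C}$ and $0\le i\le 2^m-1$, $R_{i\times(a)}$ is the $2^m\times 2^m$ row-multiplication elementary matrix: the diagonal matrix with entry $a$ in position $(i,i)$ and $1$ in all other diagonal positions. $I$ is the $2^m\times 2^m$ identity matrix. *)

(* Defs.v *)
From mathcomp Require Import all_boot all_order all_algebra.
From mathcomp Require Import reals.
From mathcomp.real_closed Require Import complex.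

Set Implicit Arguments.
Unset Strict Implicit.
Unset Printing Implicit Defensive.

Import GRing.Theory.
Local Open Scope ring_scope.

Definition row_mul_mx (R : realType) (m : nat) (i : 'I_(2 ^ m)) (a : R[i]) :
    'M[R[i]]_(2 ^ m) :=
  diag_mx (\row_(j < 2 ^ m) if j == i then a else 1).

(* Main.v *)
Require Import Defs.
From mathcomp Require Import all_boot all_order all_algebra.
From mathcomp Require Import reals.
From mathcomp.real_closed Require Import complex.

Set Implicit Arguments.
Unset Strict Implicit.
Unset Printing Implicit Defensive.

Import GRing.Theory.
Local Open Scope ring_scope.

(** For fixed [i], the map from [a] to [row_mul_mx i a] is multiplicative ([row_mul_mxM]) and sends
    1 to the identity ([row_mul_mx1]); hence it carries [a * (1 / a) = 1] to the identity matrix. *)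

Lemma row_mul_mxM (R : realType) (m : nat) (i : 'I_(2 ^ m)) (a b : R[i]) :
  row_mul_mx i a *m row_mul_mx i b = row_mul_mx i (a * b).
Proof.
rewrite /row_mul_mx mulmx_diag; congr diag_mx.
by apply/rowP=> j; rewrite !mxE; case: eqP => // _; rewrite mulr1.
Qed.

Lemma row_mul_mx1 (R : realType) (m : nat) (i : 'I_(2 ^ m)) :
  row_mul_mx i (1 : R[i]) = 1%:M.
Proof.
by apply/matrixP=> j k; rewrite !mxE if_same.
Qed.

Theorem proposition4p1 (R : realType) (m : nat) (hm : (1 <= m)%N)
    (i : 'I_(2 ^ m)) (a : R[i]) (ha : a != 0) :
  [/\ row_mul_mx i a \in unitmx,
      invmx (row_mul_mx i a) = row_mul_mx i (1 / a),
      row_mul_mx i a *m row_mul_mx i (1 / a) = 1%:M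
    & row_mul_mx i (1 / a) *m row_mul_mx i a = 1%:M].
Proof.
have mulV : row_mul_mx i a *m row_mul_mx i (1 / a) = 1%:M.
  by rewrite row_mul_mxM mul1r divff // row_mul_mx1.
(* For square matrices a one-sided inverse already gives invertibility, and it is two-sided
   ([mulmx1C]). *)
have [unit_a _] := mulmx1_unit mulV.
split=> //; last exact: mulmx1C.
(* Uniqueness of the inverse: with A B = 1, inv(A) = inv(A) (A B) = B. *)
by rewrite -[LHS]mulmx1 -mulV mulKmx.
Qed.
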